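(* Let $K_m$ be the Bernoulli-Euler numbers, and let $p_{k,d}(x)$ ($k\ge1$, $0\le d\le k-1$) be the real polynomials, of degree $k-d-1$, such that for all integers $n\ge0$, $l\ge0$ with $(n,l)\neq(0,0)$ $$K_n^l=\sum_{k=1}^{[l/2]+1}\left(\frac{(-1)^{k-1}}{2^{k-1}(k-1)!}\,\frac{l!}{(l-2k+2)!}\sum_{d=0}^{k-1}p_{k,d}(l)\,n^d\right)K_{n+2(l-k)+1}.$$ Then for every integer $l\ge1$ $$K_{2l}-l!=K_{2l}-K_1^l=\sum_{k=2}^{[l/2]+1}\left(\frac{(-1)^{k}}{2^{k-1}(k-1)!}\,\frac{l!}{(l-2k+2)!}\sum_{d=0}^{k-1}p_{k,d}(l)\right)K_{2(l-k+1)},$$ $$K_{2l+1}-2^l\,l!=K_{2l+1}-K_2^l=\sum_{k=2}^{[l/2]+1}\left(\frac{(-1)^{k}}{2^{k-1}(k-1)!}\,\frac{l!}{(l-2k+2)!}\sum_{d=0}^{k-1}p_{k,d}(l)\,2^d\right)K_{2(l-k+1)+1}.$$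
   Context: The Bernoulli-Euler numbers $K_m$ (one index), $m\ge0$, are defined by $\sec t+\tan t=\sum_{m\ge0}K_m t^m/m!$ (so $1,1,1,2,5,16,61,\dots$). Conventions: $n^0=1$; an empty sum is $0$; $[\,\cdot\,]$ is the integer part. For an integer $n\ge 1$ let $P_n$ be the space of real polynomials of the form $x^n+\lambda_2x^{n-2}+\cdots+\lambda_{n-1}x$, with the topology of the coefficients $\lambda_i\in\mathbb R$ (so $P_1=\{x\}$, $P_2=\{x^2\}$). For $l\ge 0$ consider pairs $(f;b_1,\dots,b_l)\in P_n\times\mathbb R^l$; the $b_i$ are the (labelled) boundary points and the numbers $f(b_i)$ are the boundary values. Such a pair is a very nice M-morsification of $B_n^l$ if all $n-1$ critical points of $f$ (counted with multiplicity) are real and the $n-1$ critical values together with the $l$ boundary values are all pairwise distinct. $K_n^l$ (two indices) is the number of connected components of the set of very nice M-morsifications of $B_n^l$, as a subspace of $P_n\times\mathbb R^l$. For $n=0$, $K_0^l$ (for $l\ge1$) is the number of connected components of the space of degree $0$ polynomials (the zero polynomial) with $l$ labelled real boundary points having pairwise distinct boundary values; thus $K_0^1=1$ and $K_0^l=0$ for $l\ge 2$. It is known (Arnold) that $K_n^0=K_{n-1}$ for $n\ge1$ and $K_n^1=K_{n+1}$ for $n\ge0$; and $K_{n-2}^{l+1}=K_n^l-nlK_n^{l-1}$ for $n\ge2$, $l\ge1$. *)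

(* Defs.v *)
From mathcomp Require Import all_boot all_order all_algebra finmap.
From mathcomp Require Import all_classical all_reals all_analysis.
Import Order.TTheory GRing.Theory Num.Theory.
Import numFieldNormedType.Exports.

Set Implicit Arguments.
Unset Strict Implicit.
Unset Printing Implicit Defensive.

Local Open Scope classical_set_scope.
Local Open Scope ring_scope.

(* sec t + tan t = \sum_m K_m t^m / m!, as a convergent expansion around 0;
   this determines the sequence K uniquely. *)
Definition bernoulli_euler (R : realType) (K : nat -> R) : Prop :=
  \forall t \near (0 : R),
    series (fun m => K m * t ^+ m / (m`!)%:R) @ \oo --> (cos t)^-1 + tan t.

(* The coordinate lam 0 i is lambda_(i+2), so P_n is identified, together with
   its topology, with the space 'rV[R]_(n - 2) (a point if n <= 2).
   For n = 0 the only polynomial of the family is 0. *)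
Definition param_poly (R : realType) (n : nat) (lam : 'rV[R]_(n - 2)) : {poly R} :=
  if n == 0%N then 0
  else 'X^n + \sum_(i < n - 2) lam 0 i *: 'X^(n - i.+2).
Arguments param_poly {R} n lam.

(* The n - 1 entries of s are the critical points of f, listed with
   multiplicity: all roots of f' are real, and n is the leading coefficient of
   f' when f belongs to P_n. *)
Definition critical_points (R : realType) (n : nat) (f : {poly R})
    (s : seq R) : Prop :=
  size s = n.-1 /\ f^`() = n%:R *: \prod_(c <- s) ('X - c%:P).

Definition boundary_values (R : realType) (l : nat) (f : {poly R})
    (b : 'rV[R]_l) : seq R :=
  [seq f.[b 0 i] | i <- enum 'I_l].

Definition very_nice (R : realType) (n l : nat) :
    set ('rV[R]_(n - 2) * 'rV[R]_l) :=
  [set m | let f := param_poly n m.1 in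
    if n == 0%N then uniq (boundary_values f m.2) : Prop
    else exists2 s : seq R, critical_points n f s &
           uniq ([seq f.[c] | c <- s] ++ boundary_values f m.2)].

Definition components (T : topologicalType) (A : set T) : set (set T) :=
  connected_component A @` A.

(* K_n^l.  fset_set sends an infinite set to the empty one, but very_nice is
   semialgebraic, hence has finitely many components. *)
Definition num_very_nice (R : realType) (n l : nat) : nat :=
  #|` fset_set (components (@very_nice R n l)) |.

(* Main.v *)
Require Import Defs.
From mathcomp Require Import all_boot all_order all_algebra finmap perm.
From mathcomp Require Import zify.
From mathcomp Require Import all_classical all_reals all_analysis.
Import Order.TTheory GRing.Theory Num.Theory.
Import numFieldNormedType.Exports.
Local Open Scope ring_scope.

(* For n = 1 the boundary values of x are the points b_i themselves, and for
   n = 2 the critical value of x^2 is 0 and the boundary values are the b_i^2.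
   The very nice M-morsifications are therefore the b with distinct entries, and
   those with nonzero entries of distinct absolute values.  Prescribing the order
   of the b_i (and, for n = 2, of the |b_i| together with the signs) cuts these
   sets into disjoint open convex cones, which are then the connected components:
   there are l! of them for n = 1 and 2^l l! for n = 2.  The stated identities
   are the given formula at n = 1 and n = 2, with its k = 1 term isolated; the
   coefficient of that term is 1, because p_{1,0} is a constant whose value is
   read off from K_1^0 = K_0 = 1. *)

Set Implicit Arguments.
Unset Strict Implicit.
Unset Printing Implicit Defensive.

Local Open Scope classical_set_scope.

(** * Components of a set cut into disjoint open connected pieces *)

Lemma connected_component_open_partition (T : topologicalType) (I : Type)
    (A : set T) (C : I -> set T) (i : I) (x : T) :
  A = \bigcup_j C j -> trivIset setT C -> (forall j, open (C j)) ->
  (forall j, connected (C j)) -> C i x -> connected_component A x = C i.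
Proof.
move=> AC Ctriv Copen Cconn Cix; rewrite eqEsubset; split; last first.
  by apply: connected_component_max => //; rewrite AC; exact: bigcup_sup.
have <- : connected_component A x `&` C i = connected_component A x.
  apply: component_connected.
  - exists x; split => //; apply: connected_component_refl.
    by rewrite AC; exists i.
  - by exists (C i).
  (* Relative closedness: inside [A], the piece [C i] is the complement of the open union of the
     other pieces. Being clopen and nonempty in the connected component, it fills it. *)
  - exists (~` \bigcup_(j in [set~ i]) C j).
      by apply: open_closedC; exact: bigcup_open.
    apply/seteqP; split=> y [Dy Cy]; split => //.
      move=> [j /= ji Cjy]; apply: ji.
      by apply: Ctriv => //; exists y.
    have [j _ Cjy] : (\bigcup_j C j) y.
      by rewrite -AC; exact: connected_component_sub Dy.
    have [<- //|ji] := pselect (j = i).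
    by exfalso; apply: Cy; exists j.
exact: subIsetr.
Qed.

Lemma card_components (T : topologicalType) (I : finType)
    (A : set T) (C : I -> set T) :
  A = \bigcup_i C i -> trivIset setT C -> (forall i, C i !=set0) ->
  (forall i, open (C i)) -> (forall i, connected (C i)) ->
  #|` fset_set (components A)|%fset = #|I|.
Proof.
move=> AC Ctriv C0 Copen Cconn.
have compE i x : C i x -> connected_component A x = C i.
  exact: connected_component_open_partition.
(* Indexing by ordinals through [enum_val] reduces the count to the cardinal of an initial segment
   of the naturals. Distinct indices give distinct pieces because the pieces are nonempty and
   disjoint. *)
have -> : components A = range (C \o @enum_val I predT).
  apply/seteqP; split=> [_ [x Ax <-]|_ [i _ <-]].
    move: (Ax); rewrite {1}AC => -[i _ Cix].
    by exists (enum_rank i) => //=; rewrite enum_rankK (compE i).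
  have [x Cx] := C0 (enum_val i).
  by exists x; [rewrite AC; exists (enum_val i)|exact: compE].
apply: card_fset_set.
have Cinj : injective (C \o @enum_val I predT).
  move=> i j /= Cij; apply: enum_val_inj; apply: Ctriv => //.
  by rewrite Cij setIid.
apply: card_eq_trans; first by apply: inj_card_eq; exact: in2W.
rewrite card_eq_sym; exact: card_II.
Qed.

(** Such a set is convex, hence a union of segments issuing from one of its points. *)
Lemma connected_convex_cone (R : realType) (V : normedModType R) (A : set V) :
  (forall x y, A x -> A y -> A (x + y)) ->
  (forall (t : R) x, 0 < t -> A x -> A (t *: x)) -> connected A.
Proof.
move=> AD AZ.
have [->|/set0P[x Ax]] := eqVneq A set0; first exact: connected0.
pose path y (t : R) := x + t *: (y - x).
have -> : A = \bigcup_(y in A) (path y @` `[0, 1]).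
  apply/seteqP; split=> [y Ay|_ [y Ay [t /= t01 <-]]].
    exists y => //; exists 1; first by rewrite /= in_itv /= ler01 lexx.
    by rewrite /path scale1r addrC subrK.
  move: t01; rewrite in_itv /= => /andP[t0 t1].
  (* The endpoints are treated apart: only strictly positive scalings are known to preserve [A]. *)
  have [->|tn0] := eqVneq t 0; first by rewrite /path scale0r addr0.
  have [->|tn1] := eqVneq t 1; first by rewrite /path scale1r addrC subrK.
  have -> : path y t = (1 - t) *: x + t *: y.
    by rewrite /path scalerBr scalerBl scale1r addrAC addrA.
  by apply: AD; apply: AZ; rewrite // ?subr_gt0 lt_neqAle ?t1 ?tn1 // eq_sym tn0.
apply: bigcup_connected.
  exists x => y _; exists 0; first by rewrite /= in_itv /= lexx ler01.
  by rewrite /path scale0r addr0.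
move=> y _; apply: connected_continuous_connected; first exact: segment_connected.
apply: continuous_subspaceT => t.
apply: cvgD; first exact: cvg_cst.
by apply: cvgZr_tmp; exact: cvg_id.
Qed.

(** * Permutations as orderings of injective real families *)

Section OrderedBy.
Variables (R : realType) (l : nat).
Implicit Types (u : 'I_l -> R) (s : 'S_l).

(** [s i] is the rank of [u i]. One implication suffices: both orders are total, so the converse
    follows. *)
Definition ordered_by s : set ('I_l -> R) :=
  [set u | forall i j, (s i < s j)%N -> u i < u j].

Lemma ordered_by_inj s u : ordered_by s u -> injective u.
Proof.
move=> su i j uij; apply: (@perm_inj _ s); apply: val_inj => /=.
by case: (ltngtP (s i) (s j)) => // /su; rewrite uij ltxx.
Qed.

(** Recovers [s] from the comparisons [s j < s i] alone, hence from the order of the values of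
    [u]. *)
Lemma card_perm_lt s (i : 'I_l) : #|[set j | (s j < s i)%N]%SET| = s i.
Proof.
have -> : [set j | (s j < s i)%N]%SET = s @^-1: [set k : 'I_l | (k < s i)%N]%SET.
  by apply/setP => j; rewrite !inE.
rewrite card_preimset; last exact: perm_inj.
rewrite cardsE -sum1_card -(big_ord_widen_cond _ xpredT (fun=> 1%N)) //=.
  by rewrite sum1_card card_ord.
exact: ltnW.
Qed.

Lemma ordered_by_unique s s' u : ordered_by s u -> ordered_by s' u -> s = s'.
Proof.
have ltE s1 i j : ordered_by s1 u -> (s1 i < s1 j)%N = (u i < u j).
  move=> su; apply/idP/idP => [/su //|uij].
  case: (ltngtP (s1 i) (s1 j)) => // [/su|/val_inj/perm_inj ij].
    by rewrite ltNge (ltW uij).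
  by move: uij; rewrite ij ltxx.
move=> su s'u; apply/permP => i; apply: val_inj.
rewrite /= -card_perm_lt -[RHS]card_perm_lt; apply: eq_card => j.
by rewrite !inE !ltE.
Qed.

Lemma ordered_by_exists u : injective u -> exists s, ordered_by s u.
Proof.
move=> uinj.
(* The rank of [u i] is the number of smaller values; [i] itself is not counted, so the rank stays
   below [l]. *)
have rank_lt i : (#|[set j | (u j < u i)%R]%SET| < l)%N.
  rewrite -[X in (_ < X)%N]card_ord -cardsT; apply: proper_card.
  by apply/properP; split; [exact: finset.subsetT|exists i; rewrite !inE ?ltxx].
pose r i := Ordinal (rank_lt i).
have rP i j : u i < u j -> (r i < r j)%N.
  move=> uij; apply: proper_card; apply/properP; split.
    by apply/fintype.subsetP => k; rewrite !inE => /lt_trans; apply.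
  by exists i; rewrite !inE ?ltxx.
have rinj : injective r.
  move=> i j rij; case: (ltgtP (u i) (u j)) => [/rP|/rP|/uinj //];
  by rewrite rij ltnn.
exists (perm rinj) => i j; rewrite !permE => rij.
case: (ltgtP (u i) (u j)) => [//|/rP|/uinj ij].
  by rewrite ltnNge (ltnW rij).
by move: rij; rewrite ij ltnn.
Qed.

(** The successor makes the sample values positive, so that they also give a point of an orthant. *)
Lemma perm_ordered_by s : ordered_by s (fun i => ((s i).+1)%:R).
Proof. by move=> i j sij; rewrite ltr_nat. Qed.

End OrderedBy.

(** * Open convex cones of labelled points with prescribed order and signs *)

Section LabelledChambers.
Variables (R : realType) (k l : nat).
Implicit Types (m : 'rV[R]_k * 'rV[R]_l) (sg : 'I_l -> R) (s : 'S_l).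

(** With [sg] constantly 1 these are the boundary points; with the right signs they are their
    absolute values, expressed linearly in the points. *)
Definition scaled_points sg m (i : 'I_l) : R := sg i * m.2 ord0 i.

Definition chamber sg s : set ('rV[R]_k * 'rV[R]_l) :=
  [set m | ordered_by s (scaled_points sg m)].

Definition orthant sg : set ('rV[R]_k * 'rV[R]_l) :=
  [set m | forall i, 0 < scaled_points sg m i].

Lemma scaled_pointsD sg m m' i :
  scaled_points sg (m + m') i = scaled_points sg m i + scaled_points sg m' i.
Proof. by rewrite /scaled_points mxE mulrDr. Qed.

Lemma scaled_pointsZ sg (t : R) m i :
  scaled_points sg (t *: m) i = t * scaled_points sg m i.
Proof. by rewrite /scaled_points mxE mulrCA. Qed.

Lemma scaled_points_continuous sg i : continuous (fun m => scaled_points sg m i).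
Proof.
move=> m; apply: cvgM; first exact: cvg_cst.
apply: (@continuous_comp _ _ _ snd (fun b : 'rV[R]_l => b ord0 i)).
  exact: cvg_snd.
exact: coord_continuous.
Qed.

Lemma open_chamber sg s : open (chamber sg s).
Proof.
rewrite openE => m sm.
apply: (@filter_forall _ _ (fun i => [set m' | forall j, (s i < s j)%N ->
  scaled_points sg m' i < scaled_points sg m' j]) (nbhs m)) => i.
apply: (@filter_forall _ _ (fun j => [set m' | (s i < s j)%N ->
  scaled_points sg m' i < scaled_points sg m' j]) (nbhs m)) => j.
have [sij|nsij] := boolP (s i < s j)%N; last exact: nearW.
have : open [set m | scaled_points sg m i < scaled_points sg m j].
  rewrite (_ : [set _ | _] =
    (fun m => scaled_points sg m j - scaled_points sg m i) @^-1` [set r | 0 < r]).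
    apply: open_comp; last exact: open_gt.
    move=> m' _; apply: cvgB; exact: scaled_points_continuous.
  by apply/seteqP; split => m' /=; rewrite subr_gt0.
rewrite openE => /(_ m (sm _ _ sij)).
by apply: filterS => m' /= + _.
Qed.

Lemma open_orthant sg : open (orthant sg).
Proof.
rewrite openE => m sm.
apply: (@filter_forall _ _ (fun i => [set m' | 0 < scaled_points sg m' i]) (nbhs m)) => i.
have : open ((fun m => scaled_points sg m i) @^-1` [set r | 0 < r]).
  by apply: open_comp; [move=> ? _; exact: scaled_points_continuous|exact: open_gt].
by rewrite openE => /(_ m (sm i)).
Qed.

Lemma connected_chamber sg s : connected (chamber sg s).
Proof.
apply: connected_convex_cone => [m m' sm sm'|t m t0 sm] i j sij.
  by rewrite !scaled_pointsD ltrD // ?sm ?sm'.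
by rewrite !scaled_pointsZ ltr_pM2l // sm.
Qed.

Lemma connected_orthant_chamber sg s : connected (orthant sg `&` chamber sg s).
Proof.
apply: connected_convex_cone => [m m' [pm sm] [pm' sm']|t m t0 [pm sm]].
  split=> [i|i j sij]; first by rewrite scaled_pointsD addr_gt0.
  by rewrite !scaled_pointsD ltrD // ?sm ?sm'.
split=> [i|i j sij]; first by rewrite scaled_pointsZ mulr_gt0.
by rewrite !scaled_pointsZ ltr_pM2l // sm.
Qed.

End LabelledChambers.

(** * Very nice M-morsifications for [n = 1] and [n = 2], and their count *)

Lemma very_nice1E (R : realType) (l : nat) (m : 'rV[R]_(1 - 2) * 'rV[R]_l) :
  @very_nice R 1 l m <-> injective (m.2 ord0).
Proof.
have -> : @very_nice R 1 l m <-> uniq (boundary_values (param_poly 1 m.1) m.2).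
  split=> [[[|c s] [//]]|bu]; exists nil => //.
  by split => //; rewrite /param_poly /= big_ord0 addr0 derivX big_nil scale1r.
rewrite /boundary_values (eq_map (_ : _ =1 m.2 ord0)).
  by split=> [/injectiveP //|/injectiveP].
by move=> i; rewrite /param_poly /= big_ord0 addr0 hornerX.
Qed.

Lemma very_nice2E (R : realType) (l : nat) (m : 'rV[R]_(2 - 2) * 'rV[R]_l) :
  @very_nice R 2 l m <->
  (forall i, m.2 ord0 i != 0) /\ injective (fun i => `|m.2 ord0 i|).
Proof.
have fE : param_poly 2 m.1 = 'X^2 by rewrite /param_poly /= big_ord0 addr0.
have f'E : deriv 'X^2 = 2%:R *: 'X :> {poly R}.
  by rewrite derivXn scaler_nat.
have -> : @very_nice R 2 l m <-> uniq (0 :: [seq (m.2 ord0 i) ^+ 2 | i <- enum 'I_l]).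
  have bE : boundary_values 'X^2 m.2 = [seq (m.2 ord0 i) ^+ 2 | i <- enum 'I_l].
    by apply: eq_map => i; rewrite hornerXn.
  rewrite /very_nice /= fE bE; split=> [[[|c [|? ?]] [] //= _]|u].
    (* Evaluating the factorization of the derivative at [c] gives [2 * c = 0], so the critical
       point and its value are both 0. *)
    rewrite f'E big_seq1 => /(congr1 (horner^~ c)).
    rewrite !hornerE subrr mulr0 => /eqP; rewrite mulf_eq0 pnatr_eq0 /= => /eqP ->.
    by rewrite expr0n.
  exists [:: 0]; last by rewrite /= !hornerE expr0n.
  by split => //; rewrite f'E big_seq1 subr0.
rewrite /=; split=> [/andP[z /injectiveP inj]|[nz inj]].
  split=> [i|i j ij].
    apply: contraNneq z => bi0; apply/mapP; exists i; first by rewrite mem_enum.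
    by rewrite bi0 expr0n.
  by apply: inj; rewrite -[LHS]real_normK ?num_real // ij real_normK ?num_real.
apply/andP; split.
  apply/mapP => -[i _ /esym/eqP]; rewrite sqrf_eq0; exact/negP.
apply/injectiveP => i j /eqP; rewrite eqf_sqr => /orP[] /eqP ij; apply: inj;
by rewrite ij ?normrN.
Qed.

Lemma num_very_nice1 (R : realType) (l : nat) : num_very_nice R 1 l = l`!.
Proof.
rewrite -card_Sn.
have one (m : 'rV[R]_(1 - 2) * 'rV[R]_l) :
    scaled_points (fun=> 1) m = m.2 ord0 :> ('I_l -> R).
  by apply/funext => i; rewrite /scaled_points mul1r.
apply: (card_components (C := chamber (fun=> 1))).
- apply/seteqP; split=> m.
    move=> /very_nice1E/ordered_by_exists[s sm]; exists s => //.
    by rewrite /chamber /= one.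
  move=> [s _]; rewrite /chamber /= one => /ordered_by_inj.
  by move=> inj; apply/very_nice1E.
- by move=> s s' _ _ [m [sm s'm]]; exact: ordered_by_unique sm s'm.
- move=> s; exists (0, \row_i ((s i).+1)%:R).
  rewrite /chamber /= one /= (_ : _ ord0 = fun i => ((s i).+1)%:R).
    exact: perm_ordered_by.
  by apply/funext => i; rewrite mxE.
- by move=> s; exact: open_chamber.
- by move=> s; exact: connected_chamber.
Qed.

Lemma num_very_nice2 (R : realType) (l : nat) :
  num_very_nice R 2 l = (2 ^ l * l`!)%N.
Proof.
have -> : (2 ^ l * l`!)%N = #|{: {ffun 'I_l -> bool} * 'S_l}|.
  by rewrite card_prod card_ffun card_bool card_ord card_Sn.
(* [e i] is true exactly when the [i]-th boundary point is to be negative. *)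
pose sg (e : {ffun 'I_l -> bool}) i : R := (-1) ^+ e i.
have sg_norm e i : `|sg e i| = 1 by rewrite normr_sign.
have ptsE k e (m : 'rV[R]_k * 'rV[R]_l) : orthant (sg e) m ->
    scaled_points (sg e) m = fun i => `|m.2 ord0 i|.
  move=> om; apply/funext => i.
  by rewrite -[LHS]gtr0_norm ?om // normrM sg_norm mul1r.
apply: (card_components (C := fun es => orthant (sg es.1) `&` chamber (sg es.1) es.2)).
- apply/seteqP; split=> m.
    move=> /very_nice2E[nz /ordered_by_exists[s sm]].
    pose e : {ffun 'I_l -> bool} := [ffun i => m.2 ord0 i < 0].
    have om : orthant (sg e) m.
      move=> i; rewrite /scaled_points /sg ffunE.
      by rewrite -normrEsign normr_gt0.
    by exists (e, s) => //; split => //; rewrite /chamber /= ptsE.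
  move=> [[e s] _ [/= om]]; rewrite /chamber /= ptsE // => /ordered_by_inj inj.
  apply/very_nice2E; split => // i; apply: contraTneq (om i) => b0.
  by rewrite /scaled_points b0 mulr0 ltxx.
- move=> [e s] [e' s'] _ _ [m [/= [om]]].
  rewrite /chamber /= ptsE // => sm [om']; rewrite /= ptsE // => sm'.
  (* Both permutations order the same absolute values, so they agree; differing signs would make
     some point both positive and negative. *)
  rewrite (ordered_by_unique sm sm'); congr pair; apply/ffunP => i.
  move: (om i) (om' i); rewrite /scaled_points /sg.
  case: (e i) (e' i) => [] [] //=; rewrite !expr0 !expr1 !mul1r !mulN1r oppr_gt0.
    by move=> /lt_trans/[apply]; rewrite ltxx.
  by move=> + /lt_trans => /[swap]/[apply]; rewrite ltxx.
- move=> [e s]; exists (0, \row_i (sg e i * ((s i).+1)%:R)).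
  have E : scaled_points (sg e) (0 : 'rV[R]_(2 - 2), \row_i (sg e i * ((s i).+1)%:R))
      = fun i => ((s i).+1)%:R.
    apply/funext => i; rewrite /scaled_points mxE mulrA -expr2 sqrr_sign.
    by rewrite mul1r.
  by split; rewrite /orthant /chamber /= E //; exact: perm_ordered_by.
- by move=> es; apply: openI; [exact: open_orthant|exact: open_chamber].
- by move=> es; exact: connected_orthant_chamber.
Qed.

(** * The initial value [K 0] and the two identities *)

Lemma bernoulli_euler0 (R : realType) (K : nat -> R) :
  bernoulli_euler K -> K 0%N = 1.
Proof.
move=> /nbhs_singleton; rewrite cos0 tan0 invr1 addr0 => /cvg_lim <- //.
(* At [t = 0] only the term of index 0 survives, since [0 ^+ 0 = 1]; the partial sums are constant
   as soon as they contain it. *)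
apply/esym/cvg_lim => //; apply: cvg_near_cst; exists 1%N => // n /= n0.
rewrite /series /= big_ltn // expr0 mulr1 fact0 divr1 big1_seq ?addr0 //.
move=> i /andP[_]; rewrite mem_index_iota => /andP[i0 _].
by rewrite expr0n gtn_eqF // mulr0 mul0r.
Qed.

Local Close Scope classical_set_scope.

Theorem theorem5p3 (R : realType) (K : nat -> R) (p : nat -> nat -> {poly R})
  (hK : bernoulli_euler K)
  (hdeg : forall k d : nat, (1 <= k)%N -> (d <= k - 1)%N ->
     size (p k d) = (k - d - 1).+1)
  (hp : forall n l : nat, (n, l) <> (0%N, 0%N) ->
     (num_very_nice R n l)%:R =
     \sum_(1 <= k < (l %/ 2 + 1).+1)
       ((-1) ^+ (k - 1) / (2 ^+ (k - 1) * ((k - 1)`!)%:R)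
        * ((l`!)%:R / ((l + 2 - 2 * k)`!)%:R)
        * \sum_(0 <= d < k) (p k d).[l%:R] * n%:R ^+ d)
       * K (n + 2 * l + 1 - 2 * k)%N)
  (l : nat) (hl : (1 <= l)%N) :
  (K (2 * l)%N - (l`!)%:R = K (2 * l)%N - (num_very_nice R 1 l)%:R /\
   K (2 * l)%N - (num_very_nice R 1 l)%:R =
     \sum_(2 <= k < (l %/ 2 + 1).+1)
       ((-1) ^+ k / (2 ^+ (k - 1) * ((k - 1)`!)%:R)
        * ((l`!)%:R / ((l + 2 - 2 * k)`!)%:R)
        * \sum_(0 <= d < k) (p k d).[l%:R])
       * K (2 * (l - k + 1))%N) /\
  (K (2 * l + 1)%N - 2 ^+ l * (l`!)%:R =
     K (2 * l + 1)%N - (num_very_nice R 2 l)%:R /\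
   K (2 * l + 1)%N - (num_very_nice R 2 l)%:R =
     \sum_(2 <= k < (l %/ 2 + 1).+1)
       ((-1) ^+ k / (2 ^+ (k - 1) * ((k - 1)`!)%:R)
        * ((l`!)%:R / ((l + 2 - 2 * k)`!)%:R)
        * \sum_(0 <= d < k) (p k d).[l%:R] * 2 ^+ d)
       * K (2 * (l - k + 1) + 1)%N).
Proof.
have p10 (x : R) : (p 1%N 0%N).[x] = 1.
  have [c pc] : exists c, p 1%N 0%N = c%:P.
    by exists (p 1%N 0%N)`_0; apply: size1_polyC; rewrite hdeg.
  have := hp 1%N 0%N; rewrite num_very_nice1 div0n big_nat1 big_nat1.
  rewrite pc !hornerC !subnn fact0 !expr0 !mulr1 !divr1 mul1r /=.
  by rewrite (bernoulli_euler0 hK) !(mulr1, mul1r) => <-.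
(* Common source of both identities: the [k = 1] term is [K (n + 2 * l - 1)], and moving the others
   across turns the sign [(-1) ^+ (k - 1)] into [(-1) ^+ k]. *)
have first (n : nat) : (0 < n)%N -> K (n + 2 * l - 1)%N - (num_very_nice R n l)%:R =
    \sum_(2 <= k < (l %/ 2 + 1).+1)
       ((-1) ^+ k / (2 ^+ (k - 1) * ((k - 1)`!)%:R)
        * ((l`!)%:R / ((l + 2 - 2 * k)`!)%:R)
        * \sum_(0 <= d < k) (p k d).[l%:R] * n%:R ^+ d)
       * K (n + 2 * l + 1 - 2 * k)%N.
  move=> n0; rewrite hp; last by case; case: n n0.
  rewrite big_ltn; last by rewrite addn1.
  rewrite big_nat1 p10 subnn !expr0 fact0 muln1 addnK.
  rewrite !mulr1 divr1 divff ?pnatr_eq0 -?lt0n ?fact_gt0 // !mul1r.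
  rewrite (_ : (_ + 1 - 2 = n + 2 * l - 1)%N); last by rewrite addn1 subSS.
  rewrite opprD addNKr -sumrN; apply: eq_big_nat => -[//|k] _.
  by rewrite subn1 exprS !mulN1r !mulNr.
split; split.
- by rewrite num_very_nice1.
- have := first 1%N isT; rewrite addKn => ->.
  apply: eq_big_nat => k /andP[k2 kl].
  (* No subtraction is truncated: [2 <= k <= l %/ 2 + 1] forces [k <= l]. *)
  have -> : (1 + 2 * l + 1 - 2 * k = 2 * (l - k + 1))%N by lia.
  by do 2!congr (_ * _); apply: eq_bigr => d _; rewrite expr1n mulr1.
- by rewrite num_very_nice2 natrM natrX.
- have := first 2%N isT; rewrite (_ : (2 + 2 * l - 1 = 2 * l + 1)%N); last by lia.
  move=> ->; apply: eq_big_nat => k /andP[k2 kl].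
  by have -> : (2 + 2 * l + 1 - 2 * k = 2 * (l - k + 1) + 1)%N by lia.
Qed.
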